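(* Let $F\in\mathcal{H}^d$ with homogeneity matrix $A$ and let $\mathbf{b}\in\mathbb{R}^d_{++}$ with $\sum_{i=1}^d b_i=1$ be such that $A^\top\mathbf{b}=\mathbf{b}$. Suppose that for all $\nu\in[d]$, all $l_\nu\in[n_\nu]$ and all $(j_1,\dots,j_d)\in[n_1]\times\cdots\times[n_d]$ there exists $i_\nu\in[d]$ such that there is a path from $(i_\nu,j_{i_\nu})$ to $(\nu,l_\nu)$ in the directed graph $\mathcal{G}(F)$. Then $F$ has an eigenvector in $\mathbb{S}_{++}$.
   Context: Fix positive integers $d,n_1,\dots,n_d$ and write $[n]=\{1,\dots,n\}$. Let $V=\mathbb{R}^{n_1}\times\cdots\times\mathbb{R}^{n_d}$, $\mathcal{K}_+=\mathbb{R}^{n_1}_+\times\cdots\times\mathbb{R}^{n_d}_+$ (vectors with nonnegative entries), and let $\mathcal{K}_{++}$ be its interior (all entries positive). Elements are written $\mathbf{x}=(\mathbf{x}_1,\dots,\mathbf{x}_d)$ with $\mathbf{x}_i=(x_{i,1},\dots,x_{i,n_i})\in\mathbb{R}^{n_i}$. Write $\mathbf{x}\le_{\mathcal{K}}\mathbf{y}$ if $\mathbf{y}-\mathbf{x}\in\mathcal{K}_+$. For $\boldsymbol{\alpha}\in\mathbb{R}^d$, $\mathbf{x}\in V$ set $\boldsymbol{\alpha}\otimes\mathbf{x}=(\alpha_1\mathbf{x}_1,\dots,\alpha_d\mathbf{x}_d)$. For $\boldsymbol{\alpha}\in\mathbb{R}^d_+$ and a nonnegative $d\times d$ matrix $A$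 set $\boldsymbol{\alpha}^A=(\prod_k\alpha_k^{A_{1,k}},\dots,\prod_k\alpha_k^{A_{d,k}})$ (with $0^0=1$). $\mathcal{H}^d$ is the set of continuous maps $F=(F_1,\dots,F_d):\mathcal{K}_+\to\mathcal{K}_+$ such that: (i) there is a nonnegative $d\times d$ matrix $A$ (the homogeneity matrix of $F$) with $F(\boldsymbol{\alpha}\otimes\mathbf{x})=\boldsymbol{\alpha}^A\otimes F(\mathbf{x})$ for all $\boldsymbol{\alpha}\in\mathbb{R}^d_+$, $\mathbf{x}\in\mathcal{K}_+$; (ii) $F$ is order-preserving: $\mathbf{x}\le_{\mathcal{K}}\mathbf{y}$ implies $F(\mathbf{x})\le_{\mathcal{K}}F(\mathbf{y})$; (iii) $F$ is nondegenerate: $F(\mathcal{K}_{++})\subset\mathcal{K}_{++}$ and $A\mathbb{R}^d_{++}\subset\mathbb{R}^d_{++}$. An eigenvector of $F\in\mathcal{H}^d$ is $\mathbf{x}\in\mathcal{K}_+$ with $\mathbf{x}_i\ne0$ for every $i\in[d]$ and $F(\mathbf{x})=\boldsymbol{\lambda}\otimes\mathbf{x}$ for some $\boldsymbol{\lambda}\in\mathbb{R}^d_+$. Each $\mathbb{R}^{n_i}$ carries a fixed norm $\|\cdot\|_{\gamma_i}$ that is monotonic ($|\mathbf{x}_i|\le|\mathbf{y}_i|$ entrywise implies $\|\mathbf{x}_i\|_{\gamma_i}\le\|\mathbf{y}_i\|_{\gamma_i}$), and $\mathbb{S}_{++}=\{\mathbf{x}\in\mathcal{K}_{++}:\|\mathbf{x}_i\|_{\gamma_i}=1\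 \forall i\in[d]\}$. The graph $\mathcal{G}(F)$: its node set is $\mathcal{I}=\bigcup_{i=1}^d\{i\}\times[n_i]$. For $(i,j)\in\mathcal{I}$ and $t\ge0$ let $\mathbf{u}^{(i,j)}(t)\in\mathcal{K}_+$ have $(i,j)$-entry equal to $t$ and all other entries equal to $1$. There is a directed edge from $(k,l)$ to $(i,j)$ iff $\lim_{t\to\infty}F_{k,l}(\mathbf{u}^{(i,j)}(t))=\infty$, where $F_{k,l}$ is the $l$-th component of $F_k$. Paths are directed paths; a single node counts as a path of length zero from the node to itself. *)

(* Defs.v *)
From mathcomp Require Import all_boot all_order all_algebra.
From mathcomp Require Import all_classical all_reals all_analysis.
Import Order.TTheory GRing.Theory Num.Theory.
Import numFieldNormedType.Exports.

Set Implicit Arguments.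
Unset Strict Implicit.
Unset Printing Implicit Defensive.

Local Open Scope classical_set_scope.
Local Open Scope ring_scope.

Notation prodspace R n := (prod_topology (fun i => 'rV[R]_(n i))).

Section Defs.
Variables (R : realType) (d : nat) (n : 'I_d -> nat).

Implicit Types (x y : prodspace R n) (F : prodspace R n -> prodspace R n).

Definition vec_ge0 (a : 'cV[R]_d) : Prop := forall i, 0 <= a i 0.
Definition vec_gt0 (a : 'cV[R]_d) : Prop := forall i, 0 < a i 0.

Definition Kplus : set (prodspace R n) := [set x | forall i j, 0 <= x i 0 j].
Definition Kpplus : set (prodspace R n) := [set x | forall i j, 0 < x i 0 j].

Definition leK x y : Prop := Kplus (fun i => y i - x i).

Definition otimes (a : 'cV[R]_d) x : prodspace R n := fun i => a i 0 *: x i.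

(* powR satisfies 0 `^ 0 = 1 and 0 `^ r = 0 for r > 0. *)
Definition cvpow (a : 'cV[R]_d) (A : 'M[R]_d) : 'cV[R]_d :=
  \col_i \prod_k (a k 0 `^ A i k).

(* F belongs to the class H^d, with homogeneity matrix A.  F is a total map,
   but it is only constrained on the cone Kplus. *)
Record in_Hd F (A : 'M[R]_d) : Prop := InHd {
  Hd_continuous : {within Kplus, continuous F};
  Hd_cone : forall x, Kplus x -> Kplus (F x);
  Hd_mx_ge0 : forall i j, 0 <= A i j;
  Hd_homogeneous : forall (a : 'cV[R]_d) x, vec_ge0 a -> Kplus x ->
    F (otimes a x) = otimes (cvpow a A) (F x);
  Hd_monotone : forall x y, Kplus x -> Kplus y -> leK x y -> leK (F x) (F y);
  Hd_Kpplus : forall x, Kpplus x -> Kpplus (F x);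
  Hd_mx_positive : forall a : 'cV[R]_d, vec_gt0 a -> vec_gt0 (A *m a)
}.

Definition is_eigenvector F x : Prop :=
  [/\ Kplus x, forall i, x i != 0 &
      exists2 lambda : 'cV[R]_d, vec_ge0 lambda & F x = otimes lambda x].

Record monotonic_norm m (N : 'rV[R]_m -> R) : Prop := MonotonicNorm {
  mnorm_triangle : forall u v, N (u + v) <= N u + N v;
  mnormZ : forall (c : R) u, N (c *: u) = `|c| * N u;
  mnorm_eq0 : forall u, N u = 0 -> u = 0;
  mnorm_monotonic : forall u v : 'rV[R]_m,
    (forall j, `|u 0 j| <= `|v 0 j|) -> N u <= N v
}.

Definition Spplus (gamma : forall i, 'rV[R]_(n i) -> R) : set (prodspace R n) :=
  [set x | Kpplus x /\ forall i, gamma i (x i) = 1].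

Definition node : finType := {i : 'I_d & 'I_(n i)}.

Definition mknode (i : 'I_d) (j : 'I_(n i)) : node :=
  Tagged (fun i => 'I_(n i)) j.

Definition uvec (p : node) (t : R) : prodspace R n :=
  fun i => \row_j (if mknode j == p then t else 1).

Definition edge F : rel node := fun p q =>
  `[< F (uvec q t) (tag p) 0 (tagged p) @[t --> +oo] --> +oo >].

End Defs.

(* Main.v *)
(** In logarithmic coordinates [F] becomes an order-preserving map [f] with
    [f (u + a) = f u + A a] for block-constant [a].  As [b] is a left fixed vector
    of [A], block bounds [a] on [|u - v|] propagate to bounds [A a] on
    [|f u - f v|] of the same [b]-weight, so [f / (1 + th)] is a contraction
    and there are [u] with [f u] close to [(1 + th) u].  Subtracting the minimum
    of [u] on each block gives [v >= 0] with [f v] close to [(1 + th) v + c],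
    where [c] is block-constant and bounded above independently of [th].  The
    minimisers form a choice [j] with [v = 0] at [j i]; a bound on [v] propagates
    along the edges of the graph, hence [v] is bounded uniformly in [th].
    Compactness as [th] tends to [0] yields [f v = v + c]. *)
Require Import Defs.
From mathcomp Require Import all_boot all_order all_algebra.
From mathcomp Require Import all_classical all_reals all_analysis.
From mathcomp Require Import ring lra.
Import Order.TTheory GRing.Theory Num.Theory.
Import numFieldNormedType.Exports.

Local Open Scope classical_set_scope.
Local Open Scope ring_scope.

(** Since [I] is finite, a sup-norm ball is a finite intersection of preimages under projections,
    hence a neighbourhood in the product topology. *)
Lemma continuous_finite_prod (R : realType) (I : finType)
    (g : prod_topology (fun _ : I => R) -> R) :
  (forall u eps, 0 < eps -> exists2 del, 0 < del &
    forall v : I -> R, (forall q, `|u q - v q| <= del) -> `|g u - g v| <= eps) ->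
  continuous g.
Proof.
move=> h u; apply/(@cvgrPdist_le _ _ _ (nbhs u)) => eps eps0.
have [del del0 H] := h u eps eps0.
have Fu : Filter (nbhs u) by exact: nbhs_filter.
apply: (@filterS _ (nbhs u) Fu _ _ H).
apply: (@filter_forall (I -> R) I _ (nbhs u) Fu) => q.
have /cvgrPdist_le /(_ del del0) : proj q @ u --> proj q u by exact: proj_continuous.
exact.
Qed.

(** * The additive eigenproblem with block-constant shifts *)

Section AdditiveEigenproblem.
Variables (R : realType) (I J : finType) (t : I -> J).
Variables (A : J -> J -> R) (b : J -> R) (f : (I -> R) -> I -> R).

Let mulA (a : J -> R) (i : J) : R := \sum_k A i k * a k.

Hypothesis A_ge0 : forall i k, 0 <= A i k.
Hypothesis b_gt0 : forall i, 0 < b i.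
Hypothesis bA : forall k, \sum_i b i * A i k = b k.
Hypothesis f_mono : forall u v, (forall p, u p <= v p) -> forall p, f u p <= f v p.
Hypothesis f_shift : forall u (a : J -> R) p,
  f (fun q => u q + a (t q)) p = f u p + mulA a (t p).

Let weight (a : J -> R) : R := \sum_i b i * a i.

Let weight_mulA a : weight (mulA a) = weight a.
Proof.
rewrite /weight /mulA; under eq_bigr => i _ do rewrite big_distrr /=.
rewrite exchange_big /=; apply: eq_bigr => k _.
by rewrite -[in RHS]bA big_distrl /=; apply: eq_bigr => i _; rewrite mulrA.
Qed.

Let mulA_ge0 a : (forall i, 0 <= a i) -> forall i, 0 <= mulA a i.
Proof. by move=> a0 i; apply: sumr_ge0 => k _; rewrite mulr_ge0. Qed.

(** A common bound for all [(b i)^-1], used to pass from weights back to entries. *)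
Let S := \sum_i (b i)^-1.

Let S_ge0 : 0 <= S.
Proof. by apply: sumr_ge0 => k _; rewrite invr_ge0 ltW. Qed.

Let weight_ge0 a : (forall i, 0 <= a i) -> 0 <= weight a.
Proof. by move=> a0; apply: sumr_ge0 => i _; rewrite mulr_ge0 // ltW. Qed.

Let le_weight a : (forall i, 0 <= a i) -> forall i, a i <= weight a * S.
Proof.
move=> a0 i; apply: (@le_trans _ _ (weight a * (b i)^-1)).
  rewrite ler_pdivlMr // mulrC /weight (bigD1 i) //= lerDl.
  by apply: sumr_ge0 => k _; rewrite mulr_ge0 // ltW.
rewrite ler_wpM2l ?weight_ge0 // /S (bigD1 i) //= lerDl.
by apply: sumr_ge0 => k _; rewrite invr_ge0 ltW.
Qed.

Let le_sum_norm (T : finType) (u : T -> R) p : `|u p| <= \sum_q `|u q|.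
Proof. by rewrite (bigD1 p) //= lerDl sumr_ge0. Qed.

(** Monotonicity applied to [u <= v + a] and the shift rule give [f u <= f v + A a]; exchanging [u]
    and [v] gives the other half. *)
Lemma nonexpansive_blockwise u v (a : J -> R) :
  (forall p, `|u p - v p| <= a (t p)) ->
  forall p, `|f u p - f v p| <= mulA a (t p).
Proof.
have half u' v' : (forall p, `|u' p - v' p| <= a (t p)) ->
    forall p, f u' p - f v' p <= mulA a (t p).
  move=> uv p; rewrite lerBlDl -f_shift; apply: f_mono => q.
  by rewrite -lerBlDl (le_trans (ler_norm _)).
move=> uv p; rewrite ler_norml half // andbT lerNl opprB half // => q.
by rewrite distrC.
Qed.

(** Iterating [c f] from 0 with [c = 1 / (1 + th)], step [k] is bounded blockwise by [a k], of
    weight [c ^+ k * W]. A late iterate suffices, so no limit is taken. *)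
Lemma discounted_approx_fixpoint : exists C : R, forall th, 0 < th -> th <= 1 ->
  exists u, (forall p, `|f u p - (1 + th) * u p| <= th) /\
            (forall p, th * `|u p| <= C).
Proof.
pose C0 := \sum_p `|f (fun=> 0) p|.
have C0_ge0 : 0 <= C0 by apply: sumr_ge0.
pose W := weight (fun=> C0).
have W_ge0 : 0 <= W by exact: weight_ge0.
exists (2 * W * S) => th th0 th1.
pose c := (1 + th)^-1.
have c0 : 0 < c by rewrite invr_gt0; lra.
have c1 : c < 1 by rewrite invf_lt1; lra.
have cE : c * (1 + th) = 1 by rewrite mulVf //; lra.
pose x k := iter k (fun u p => c * f u p) (fun=> 0).
pose a k := iter k (fun a i => c * mulA a i) (fun=> C0).
have a_ge0 k i : 0 <= a k i.
  by elim: k i => [//|k IH] i /=; rewrite mulr_ge0 ?mulA_ge0 // ltW.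
have wa k : weight (a k) = c ^+ k * W.
  elim: k => [|k IH]; first by rewrite mul1r.
  rewrite exprS -mulrA -IH -(weight_mulA (a k)) /weight big_distrr /=.
  by apply: eq_bigr => i _; rewrite mulrCA.
have step k p : `|x k.+1 p - x k p| <= a k (t p).
  elim: k p => [|k IH] p.
    rewrite /= subr0 normrM gtr0_norm //.
    apply: le_trans (le_sum_norm _ (f (fun=> 0)) p).
    by rewrite ler_piMl // ltW.
  rewrite -[leLHS]/`|c * f (x k.+1) p - c * f (x k) p|.
  rewrite -mulrBr normrM gtr0_norm // -[leRHS]/(c * mulA (a k) (t p)).
  by rewrite ler_pM2l //; apply: nonexpansive_blockwise.
pose w k i := \sum_(l < k) a l i.
have xw k p : `|x k p| <= w k (t p).
  elim: k => [|k IH]; first by rewrite normr0 /w big_ord0.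
  rewrite -[x k.+1 p](subrK (x k p)) addrC (le_trans (ler_normD _ _)) //.
  by rewrite /w big_ord_recr lerD.
(* The geometric sum is at most [1 / (1 - c) = (1 + th) / th], and [1 + th <= 2]. *)
have ww k : th * weight (w k) <= 2 * W.
  have -> : weight (w k) = (\sum_(l < k) c ^+ l) * W.
    rewrite /weight /w big_distrl /=.
    under eq_bigr => i _ do rewrite big_distrr /=.
    by rewrite exchange_big /=; apply: eq_bigr => l _; rewrite -wa.
  rewrite mulrA ler_wpM2r //.
  have := subrX1 c k; set s := \sum_(l < k) _ => cs.
  have ck : 0 <= c ^+ k by rewrite exprn_ge0 // ltW.
  have s0 : 0 <= s by apply: sumr_ge0 => l _; rewrite exprn_ge0 // ltW.
  have -> : th * s = (1 + th) * (1 - c ^+ k).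
    have -> : 1 - c ^+ k = (1 - c) * s by rewrite -opprB cs -mulNr opprB.
    by rewrite mulrA; congr (_ * _); rewrite mulrBr mulr1 mulrC; lra.
  nra.
(* The residual is [1 + th <= 2] times the step from [x k] to [x k.+1], so a step of size [th / 2]
   is small enough. *)
have [k ck] : exists k, c ^+ k * (W * S) <= th / 2.
  have cv : c ^+ k * (W * S) @[k --> \oo] --> (0 : R).
    rewrite -[X in _ --> X](mul0r (W * S)); apply: cvgMr_tmp.
    by apply: cvg_expr; rewrite gtr0_norm.
  have th2 : 0 < th / 2 by lra.
  have /cvgrPdist_le /(_ _ th2) := cv.
  move=> [k _ /(_ k (leqnn k))] /=; rewrite sub0r normrN => h.
  by exists k; apply: le_trans (ler_norm _) h.
exists (x k); split => p.
  have -> : f (x k) p - (1 + th) * x k p = (1 + th) * (x k.+1 p - x k p).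
    by rewrite mulrBr -[x k.+1 p]/(c * f (x k) p) mulrA (mulrC _ c) cE mul1r.
  have th2 : 0 <= 1 + th by lra.
  rewrite normrM (ger0_norm th2).
  have h : `|x k.+1 p - x k p| <= th / 2.
    apply: le_trans (step k p) _; apply: le_trans (le_weight _ (a_ge0 k) _) _.
    by rewrite wa -mulrA.
  have := normr_ge0 (x k.+1 p - x k p); nra.
have w0 i : 0 <= w k i by apply: sumr_ge0 => l _.
apply: (@le_trans _ _ (th * (weight (w k) * S))).
  by rewrite ler_pM2l // (le_trans (xw k p)) // le_weight.
by rewrite mulrA ler_wpM2r.
Qed.

Variable j0 : J -> I.
Hypothesis j0K : cancel j0 t.

(** The upper bound on [c] comes from a lower bound and a weight bound: [c] is nearly [f v >= f 0]
    at the minimisers, and since [A] preserves weight, [c] has the weight of [th * u] at the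
    minimisers. *)
Lemma normalized_approx_eigenvector : exists C : R, forall th, 0 < th -> th <= 1 ->
  exists v c (j : J -> I), [/\ cancel j t, forall p, 0 <= v p,
    forall i, v (j i) = 0, forall i, c i <= C &
    forall p, `|f v p - (1 + th) * v p - c (t p)| <= th].
Proof.
have [C hC] := discounted_approx_fixpoint.
(* The summand 1 absorbs the error [th <= 1] in [c_ge]. *)
pose C0 := \sum_p `|f (fun=> 0) p| + 1.
have C0_ge0 : 0 <= C0 by rewrite addr_ge0 // sumr_ge0.
pose D := weight (fun=> `|C| + C0).
exists (D * S) => th th0 th1.
have [u [fu thu]] := hC th th0 th1.
pose j i := [arg min_(p < j0 i | t p == i) u p]%O.
have jP i : t (j i) = i /\ forall p, t p = i -> u (j i) <= u p.
  rewrite /j; case: arg_minP => [|p /eqP tp hp]; first by rewrite j0K.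
  by split=> // q /eqP; apply: hp.
have jK : cancel j t by move=> i; case: (jP i).
pose v p := u p - u (j (t p)).
pose c i := (1 + th) * u (j i) - mulA (u \o j) i.
have v0 p : 0 <= v p by rewrite subr_ge0; case: (jP (t p)) => _; apply.
have vj i : v (j i) = 0 by rewrite /v jK subrr.
have fv p : f v p - (1 + th) * v p - c (t p) = f u p - (1 + th) * u p.
  have -> : f u p = f v p + mulA (u \o j) (t p).
    rewrite -f_shift; congr (f _ p); apply/funext => q /=.
    by rewrite /v subrK.
  by rewrite /v /c; ring.
have fvc p : `|f v p - (1 + th) * v p - c (t p)| <= th by rewrite fv.
exists v, c, j; split => // i.
have c_ge k : - C0 <= c k.
  have := fvc (j k); rewrite vj mulr0 subr0 jK => /ler_normlP[_ h].
  have h0 : f (fun=> 0) (j k) <= f v (j k) by apply: f_mono.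
  have := le_sum_norm _ (f (fun=> 0)) (j k).
  have := ler_norm (- f (fun=> 0) (j k)); rewrite normrN /C0; lra.
have weightD a a' : weight (fun k => a k + a' k) = weight a + weight a'.
  by rewrite /weight -big_split; apply: eq_bigr => k _; rewrite mulrDr.
have wc : weight c = weight (fun k => th * u (j k)).
  apply: (addIr (weight (mulA (u \o j)))).
  rewrite -weightD weight_mulA -weightD /weight.
  by apply: eq_bigr => k _; rewrite /c /=; ring.
have wcD : weight (fun k => c k + C0) <= D.
  rewrite weightD wc -weightD.
  apply: ler_sum => k _; rewrite ler_pM2l // lerD2r.
  apply: le_trans (ler_norm _) _; rewrite normrM (gtr0_norm th0).
  exact: le_trans (thu _) (ler_norm _).
have c1 k : 0 <= c k + C0 by have := c_ge k; lra.
have := le_weight _ c1 i => h.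
apply: (@le_trans _ _ (c i + C0)); first lra.
by apply: le_trans h _; rewrite ler_wpM2r.
Qed.

Variable e : rel I.
Hypothesis e_unbounded : forall p q, e p q -> forall K : R, exists T : R,
  forall s, f (fun r => if r == q then s else 0) p <= K -> s <= T.
(** All sections [j] are allowed because the block minimisers vary with [th]. *)
Hypothesis e_path : forall j, cancel j t -> forall q, exists i, connect e (j i) q.

(* Bounds propagate along edges: [f v p] is bounded when [v p] is, and it
   dominates [f] at the vector whose only nonzero entry is [v q]. *)
Lemma bounded_approx_eigenvector : exists B : R, forall th, 0 < th -> th <= 1 ->
  exists v c, [/\ forall p, 0 <= v p <= B &
    forall p, `|f v p - (1 + th) * v p - c (t p)| <= th].
Proof.
have [C hC] := normalized_approx_eigenvector.
pose good th v c := [/\ 0 < th, th <= 1, forall p, 0 <= v p, forall i, c i <= C &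
    forall p, `|f v p - (1 + th) * v p - c (t p)| <= th].
(* The order of quantifiers makes [K'] independent of [th], [v] and [c]. *)
pose bounds p q := forall K : R, exists K' : R, forall th v c, good th v c ->
  v p <= K -> v q <= K'.
have bounds_edge p q : e p q -> bounds p q.
  move=> epq K; have [T hT] := e_unbounded p q epq (2 * `|K| + C + 1).
  exists T => th v c [th0 th1 v0 cC fv] vpK; apply: hT.
  apply: (@le_trans _ _ (f v p)).
    by apply: f_mono => r; case: eqP => // ->.
  have /ler_normlP[_] := fv p; have := cC (t p); have := v0 p.
  by have := ler_norm K; nra.
have bounds_path p q : connect e p q -> bounds p q.
  case/connectP => s + ->; elim: s p => [|r s IH] p /=.
    by move=> _ K; exists K.
  case/andP => epr /IH hr K; have [K1 h1] := bounds_edge p r epr K.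
  have [K2 h2] := hr K1; exists K2 => th v c g vp.
  by apply: (h2 th v c g); apply: h1 g vp.
(* The starting node [j i] depends on [th], so bounds are chosen for all pairs and summed; 0 is a
   dummy for unconnected pairs. *)
have bnd p q : exists B : R, connect e p q -> forall th v c, good th v c ->
    v p <= 0 -> v q <= B.
  case: (boolP (connect e p q)) => [/bounds_path /(_ 0)[B hB]|_]; last by exists 0.
  by exists B.
pose B0 p q := sval (cid (bnd p q)).
have B0P p q := svalP (cid (bnd p q)).
pose B := \sum_p \sum_q `|B0 p q|.
exists B => th th0 th1; have [v [c [j [jK v0 vj cC fv]]]] := hC th th0 th1.
exists v, c; split => // q; rewrite v0 /=.
have [i ci] := e_path j jK q.
apply: (@le_trans _ _ (B0 (j i) q)).
  by apply: (B0P (j i) q ci th v c); rewrite ?vj.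
rewrite /B (bigD1 (j i)) //= (bigD1 q) //=.
apply: le_trans (ler_norm _) _; rewrite -addrA lerDl addr_ge0 // sumr_ge0 //.
by move=> p _; apply: sumr_ge0.
Qed.

Lemma continuous_entry p :
  continuous (fun u : prod_topology (fun _ : I => R) => f u p).
Proof.
apply: continuous_finite_prod => u eps eps0.
(* A Lipschitz constant for the sup norm: a row sum of [A], plus 1 to make it positive. *)
pose L := 1 + mulA (fun=> 1) (t p).
have L0 : 0 < L by rewrite ltr_pwDl // mulA_ge0.
exists (eps / L) => [|v uv]; first by rewrite divr_gt0.
apply: le_trans (nonexpansive_blockwise _ _ (fun=> eps / L) uv p) _.
have -> : mulA (fun=> eps / L) (t p) = eps / L * mulA (fun=> 1) (t p).
  by rewrite /mulA big_distrr /=; apply: eq_bigr => k _; rewrite mulr1 mulrC.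
by rewrite -mulrA ler_piMr ?ltW // mulrC ltr_pdivrMr // mul1r ltrDr.
Qed.

(** [defect] vanishes exactly when [f v - v] is constant on blocks. It is continuous and takes
    arbitrarily small values on a compact box, so its minimum there is 0. *)
Theorem additive_eigenvector : exists v c, forall p, f v p = v p + c (t p).
Proof.
have [B hB] := bounded_approx_eigenvector.
pose T := prod_topology (fun _ : I => R).
pose box : set T := [set v | forall p, `[0, B]%classic (v p)].
have box_compact : compact box.
  exact: (@tychonoff I (fun=> R) (fun=> `[0, B]%classic) (fun=> @segment_compact R 0 B)).
pose g (v : T) p := f v p - v p.
pose defect (v : T) := \sum_p `|g v p - g v (j0 (t p))|.
have g_cont p : continuous (g ^~ p).
  move=> v; have Fv : Filter (nbhs v) by exact: nbhs_filter.
  apply: (@cvgB _ _ _ (nbhs v) Fv (f ^~ p) (proj p)); first exact: continuous_entry.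
  exact: (@proj_continuous I (fun=> R) p v).
have defect_cont : continuous defect.
  apply: continuous_big => [|p _ v]; first exact: add_continuous.
  have Fv : Filter (nbhs v) by exact: nbhs_filter.
  apply: (@cvg_norm _ _ _ (nbhs v) Fv).
  by apply: (@cvgB _ _ _ (nbhs v) Fv (g ^~ p)); exact: g_cont.
have approx eps : 0 < eps -> exists2 v, box v & defect v <= eps.
  move=> eps0; pose N : R := #|I|%:R; have N0 : 0 <= N by [].
  (* Each of the [N] summands of [defect] is at most [2 * th * (1 + |B|)], so the total is at most
     [th * (M - 1)]. *)
  pose M := 1 + 2 * (1 + `|B|) * N.
  have M1 : 1 <= M by rewrite lerDl !mulr_ge0 // addr_ge0.
  have M0 : 0 < M by lra.
  pose th := Num.min 1 (eps / M).
  have th0 : 0 < th by rewrite lt_min ltr01 divr_gt0.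
  have th1 : th <= 1 by rewrite ge_min lexx.
  have thM : th * M <= eps by rewrite -ler_pdivlMr // ge_min lexx orbT.
  have [v [c [v0B fv]]] := hB th th0 th1.
  exists v => [p|]; first by rewrite /= in_itv /= v0B.
  have gc p : `|g v p - c (t p)| <= th * (1 + `|B|).
    have -> : g v p - c (t p) = f v p - (1 + th) * v p - c (t p) + th * v p.
      by rewrite /g; ring.
    apply: le_trans (ler_normD _ _) _; rewrite mulrDr mulr1 lerD //.
    have /andP[vp0 vpB] := v0B p.
    by rewrite normrM gtr0_norm // ler_pM2l // ger0_norm // (le_trans vpB) ?ler_norm.
  apply: (@le_trans _ _ (\sum_(p : I) (2 * (th * (1 + `|B|))))).
    apply: ler_sum => p _; have := gc p; have := gc (j0 (t p)); rewrite j0K.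
    move=> /ler_normlP[h1 h2] /ler_normlP[h3 h4]; apply/ler_normlP; split; lra.
  apply: (@le_trans _ _ (2 * (th * (1 + `|B|)) * N)).
    by rewrite sumr_const -[leLHS]mulr_natr.
  apply: le_trans thM.
  have -> : 2 * (th * (1 + `|B|)) * N = th * (M - 1) by rewrite /M; ring.
  by rewrite ler_pM2l //; lra.
have box0 : box !=set0 by have [v hv _] := approx 1 ltr01; exists v.
have [v _ vmin] := compact_EVT_min box0 box_compact (continuous_subspaceT defect_cont).
have dv0 : defect v <= 0.
  apply/ler_addgt0Pl => eps eps0; have [w boxw dw] := approx eps eps0.
  by rewrite addr0; apply: le_trans dw; apply: vmin; rewrite inE.
exists v, (fun i => g v (j0 i)) => p.
have : `|g v p - g v (j0 (t p))| <= 0.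
  apply: le_trans dv0; rewrite /defect (bigD1 p) //= lerDl.
  by apply: sumr_ge0.
rewrite normr_le0 subr_eq0 => /eqP <-.
by rewrite /g addrC subrK.
Qed.

End AdditiveEigenproblem.

(** * Passage to logarithmic coordinates *)

Section LogCoordinates.
Variables (R : realType) (d : nat) (n : 'I_d -> nat).
Variables (F : prodspace R n -> prodspace R n) (A : 'M[R]_d).
Hypothesis hF : in_Hd F A.

Definition exp_coord (u : node n -> R) : prodspace R n :=
  fun i => \row_j expR (u (mknode j)).

Definition log_map (u : node n -> R) (p : node n) : R :=
  ln (F (exp_coord u) (tag p) 0 (tagged p)).

Lemma exp_coord_gt0 u : Kpplus (exp_coord u).
Proof. by move=> i j; rewrite mxE expR_gt0. Qed.

Lemma Kpplus_sub x : Kpplus x -> @Kplus R d n x.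
Proof. by move=> x0 i j; rewrite ltW. Qed.

Let exp_coord_ge0 u : Kplus (exp_coord u).
Proof. exact/Kpplus_sub/exp_coord_gt0. Qed.

Let F_exp_gt0 u : Kpplus (F (exp_coord u)).
Proof. exact/(Hd_Kpplus hF)/exp_coord_gt0. Qed.

Lemma log_mapK u : exp_coord (log_map u) = F (exp_coord u).
Proof.
apply: functional_extensionality_dep => i; apply/rowP => j.
by rewrite mxE /log_map /= lnK // posrE F_exp_gt0.
Qed.

Lemma exp_coord_shift u (a : 'I_d -> R) :
  exp_coord (fun p => u p + a (tag p)) =
  otimes (\col_i expR (a i)) (exp_coord u).
Proof.
apply: functional_extensionality_dep => i; apply/rowP => j.
by rewrite !mxE expRD mulrC.
Qed.

Lemma log_map_mono u v : (forall p, u p <= v p) ->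
  forall p, log_map u p <= log_map v p.
Proof.
move=> uv p; rewrite ler_ln ?posrE; try exact: F_exp_gt0.
have : leK (exp_coord u) (exp_coord v).
  by move=> i j; rewrite !mxE subr_ge0 ler_expR.
move=> /(Hd_monotone hF (exp_coord_ge0 u) (exp_coord_ge0 v)) /(_ (tag p) (tagged p)).
by rewrite !mxE subr_ge0.
Qed.

Lemma log_map_shift u (a : 'I_d -> R) p :
  log_map (fun q => u q + a (tag q)) p =
  log_map u p + \sum_k A (tag p) k * a k.
Proof.
rewrite /log_map exp_coord_shift (Hd_homogeneous hF) //; last first.
  by move=> i; rewrite mxE ltW // expR_gt0.
rewrite !mxE lnM ?posrE ?F_exp_gt0 //; last first.
  by apply: prodr_gt0 => k _; rewrite powR_gt0 // mxE expR_gt0.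
rewrite addrC; congr (_ + _).
under eq_bigr => k _ do rewrite mxE -expRM mulrC.
by rewrite -expR_sum expRK.
Qed.

Lemma edge_log_map p q : edge F p q -> forall K : R, exists T : R,
  forall s, log_map (fun r => if r == q then s else 0) p <= K -> s <= T.
Proof.
move=> /asboolP Fq K; have [M [_ hM]] := cvgry_gt Fq (expR K).
have uvecE s : exp_coord (fun r => if r == q then s else 0) = uvec q (expR s).
  apply: functional_extensionality_dep => i; apply/rowP => j.
  by rewrite !mxE; case: eqP => // _; rewrite expR0.
(* The threshold for [expR s] also serves for [s], since [expR s >= 1 + s]. *)
exists M => s; apply: contra_le => Ms.
rewrite /log_map -[ltLHS]expRK ltr_ln ?posrE ?expR_gt0 //; last exact: F_exp_gt0.
by rewrite uvecE; apply: hM; have := expR_ge1Dx s; lra.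
Qed.

Lemma exp_coord_eigenvector u (c : 'I_d -> R) :
  (forall p, log_map u p = u p + c (tag p)) ->
  F (exp_coord u) = otimes (\col_i expR (c i)) (exp_coord u).
Proof.
by move=> uc; rewrite -log_mapK -exp_coord_shift; congr exp_coord; apply/funext.
Qed.

End LogCoordinates.

(** * Positivity of monotonic norms *)

Section Normalization.
Variables (R : realType) (m : nat) (N : 'rV[R]_m -> R).
Hypothesis hN : monotonic_norm N.

(** Nonnegativity follows from monotonicity by comparison with the zero vector. *)
Lemma monotonic_norm_gt0 u : u != 0 -> 0 < N u.
Proof.
have N0 : N 0 = 0 by rewrite -(scale0r 0) (mnormZ hN) normr0 mul0r.
move=> u0; rewrite lt_neqAle; apply/andP; split.
  by apply: contra u0 => /eqP /esym /(mnorm_eq0 hN) ->.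
by rewrite -N0; apply: (mnorm_monotonic hN) => j; rewrite mxE normr0.
Qed.

End Normalization.

(** * Existence of the positive eigenvector and its normalization *)

Theorem theorem5p2 (R : realType) (d : nat) (n : 'I_d -> nat)
  (d_gt0 : (0 < d)%N) (n_gt0 : forall i, (0 < n i)%N)
  (gamma : forall i : 'I_d, 'rV[R]_(n i) -> R)
  (gamma_norm : forall i, monotonic_norm (gamma i))
  (F : prodspace R n -> prodspace R n) (A : 'M[R]_d) (hF : in_Hd F A)
  (b : 'cV[R]_d) (b_gt0 : vec_gt0 b) (b_sum : \sum_i b i 0 = 1)
  (Ab : A^T *m b = b)
  (hpath : forall (nu : 'I_d) (l : 'I_(n nu)) (j : forall i : 'I_d, 'I_(n i)),
    exists i : 'I_d, connect (edge F) (mknode (j i)) (mknode l)) :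
  exists x : prodspace R n, is_eigenvector F x /\ Spplus gamma x.
Proof.
have [u [c uc]] : exists u c, forall p, @log_map R d n F u p = u p + c (tag p).
  apply: (@additive_eigenvector R (node n) 'I_d (@tag _ _) (fun i k => A i k)
    (fun i => b i 0) (@log_map R d n F) _ _ _ _ _
    (fun i => mknode (Ordinal (n_gt0 i))) _ (edge F)).
  - exact: Hd_mx_ge0 hF.
  - exact: b_gt0.
  - move=> k; rewrite -[in RHS]Ab mxE; apply: eq_bigr => i _.
    by rewrite mxE mulrC.
  - exact: (log_map_mono _ _ _ _ _ hF).
  - exact: (log_map_shift _ _ _ _ _ hF).
  - by [].
  - exact: (edge_log_map _ _ _ _ _ hF).
  - move=> j jK [nu l].
    (* Casting along [jK i] turns a section of [tag] into the dependent family required by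
       [hpath]. *)
    have jE i : j i = mknode (ecast z 'I_(n z) (jK i) (tagged (j i))).
      by move: (jK i); case: (j i) => i' l' /= e; case: _ / e.
    have [i hi] := hpath nu l (fun i => ecast z 'I_(n z) (jK i) (tagged (j i))).
    by exists i; rewrite jE.
pose x := @exp_coord R d n u.
have x0 : Kpplus x by exact: exp_coord_gt0.
have xi0 i : x i != 0.
  apply/eqP => xi; have := x0 i (Ordinal (n_gt0 i)).
  by rewrite xi mxE ltxx.
have N0 i : 0 < gamma i (x i) .
  exact: (monotonic_norm_gt0 _ _ _ (gamma_norm i) _ (xi0 i)).
pose a : 'cV[R]_d := \col_i (gamma i (x i))^-1.
have a0 : vec_gt0 a by move=> i; rewrite mxE invr_gt0.
have ax0 : Kpplus (otimes a x) by move=> i j; rewrite mxE mulr_gt0.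
exists (otimes a x); split; last first.
  split => // i; rewrite (mnormZ (gamma_norm i)) mxE gtr0_norm ?invr_gt0 //.
  by rewrite mulVf // gt_eqF.
split; first exact: Kpplus_sub.
  by move=> i; rewrite scaler_eq0 negb_or xi0 andbT gt_eqF.
have a_ge0 : vec_ge0 a by move=> i; rewrite ltW.
pose aA := cvpow a A.
(* Homogeneity multiplies block [i] of [F x] by [aA i 0]; dividing by [a i 0] expresses the result
   as a multiple of the rescaled vector. *)
exists (\col_i (aA i 0 * expR (c i) / a i 0)).
  move=> i; rewrite mxE !mulr_ge0 ?expR_ge0 ?invr_ge0 ?a_ge0 //.
  by rewrite mxE; apply: prodr_ge0 => k _; exact: powR_ge0.
rewrite (Hd_homogeneous hF) //; last exact: Kpplus_sub.
rewrite (exp_coord_eigenvector _ _ _ _ _ hF _ _ uc).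
apply: functional_extensionality_dep => i; apply/rowP => j.
rewrite !mxE -/x; field.
by rewrite gt_eqF.
Qed.
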